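(* Let $\mathcal{P}$ be a regular $n$-polytope with simple Petrie polygons, and suppose $\mathcal{P}$ is non-degenerate and not self-dual. Let $\Gamma=\Gamma(\mathcal{P})=\langle\rho_0,\dots,\rho_{n-1}\rangle$ with distinguished generators $\rho_i$. Let $\mathcal{X}$ be the family-1 premaniplex with $n$ sides, with 1-faces $e_0,\dots,e_{n-1}$, and let $\xi$ be the voltage assignment on $\mathcal{X}$ giving trivial voltage to all darts of colors 0 and 1 and voltage $\rho_i$ to each dart of color 2 whose initial flag lies in $e_i$. Then the derived graph $\mathcal{X}^\xi$ is a polyhedron (abstract 3-polytope) whose symmetry type graph is isomorphic to $\mathcal{X}$. In particular $\mathcal{X}^\xi$ is vertex-transitive, facet-transitive and has trivial facet stabilizer.
   Context: Graphs may have semi-edges and parallel edges: a graph has vertices, darts, an initial-vertex map $I$ and an involution $d\mapsto d^{-1}$ on darts; $T(d)=I(d^{-1})$. An $n$-premaniplex is a connected graph with edges colored by $\{0,\dots,n-1\}$ such that every vertex (flag) is incident to exactly one edge of each color and for $|i-j|>1$ alternating paths of length 4 in colors $i,j$ are closed; an $n$-maniplex is a simple $n$-premaniplex. $r_i\Phi$ is the flag joined to $\Phi$ by its edge of color $i$. The $i$-faces are the connected components after deleting the color-$i$ edges ($0$-faces: vertices; $(n-1)$-faces: facets). Automorphisms are color-preserving graph automorphisms, acting on the right; $\Gamma(\mathcal{M})$ is the automorphism group. An abstract $n$-polytope is an $n$-maniplex such that whenever two flags are joined by a path with colors in $[0,m]$ and by one with colors in $[k,n-1]$, they are joined by a path with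 colors in $[k,m]$; a polyhedron is a 3-polytope. $\mathcal{P}$ is regular if $\Gamma(\mathcal{P})$ is transitive on flags; fixing a base flag $\Phi$, $\rho_i$ is the automorphism with $\Phi\rho_i=r_i\Phi$. $\mathcal{P}$ is non-degenerate if no $(r_ir_{i+1})^2$ fixes a flag. The dual of $\mathcal{P}$ recolors each color $i$ as $n-1-i$; $\mathcal{P}$ is self-dual if isomorphic to its dual. A Petrie polygon is an orbit of flags under $r_{n-1}\cdots r_1r_0$; it is simple if distinct flags in it lie in distinct vertices. Family-1 premaniplex with $n$ sides: start from an $n$-gon (a 2-premaniplex whose $2n$ flags form a cycle alternating colors 0,1), fix a flag $y_0$, let $e_i$ ($0\le i\le n-1$) be the 1-face $\{(r_1r_0)^iy_0,\ r_0(r_1r_0)^iy_0\}$, and add for each $i$ an edge of color 2 joining the two flags of $e_i$. A voltage assignment on a graph $\mathcal{X}$ with group $\Gamma$ is a map $\xi$ from darts to $\Gamma$ with $\xi(d^{-1})=\xi(d)^{-1}$. The derived graph $\mathcal{X}^\xi$ has vertex set $V(\mathcal{X})\times\Gamma$ and dart set $D(\mathcal{X})\times\Gamma$, where the dart $(d,\gamma)$ goes from $(I(d),\gamma)$ to $(T(d),\xi(d)\gamma)$, with $(d,\gamma)^{-1}=(d^{-1},\xi(d)\gamma)$, and colors inherited from $\mathcal{X}$. The symmetry type graph of a maniplex is the quotient by its automorphism group: vertices are flag orbits, with an edge of color $i$ between the orbits of $\Phi$ and $r_i\Phi$ (a semi-edge if equal). Vertex-/facet-transitive means $\Gamma$ transitive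 on vertices/facets; trivial facet stabilizer means only the identity maps a facet to itself. *)

(* Defs.v *)
From HB Require Import structures.
From mathcomp Require Import all_boot all_classical.

Set Implicit Arguments.
Unset Strict Implicit.
Unset Printing Implicit Defensive.

Local Open Scope classical_set_scope.

(* Graphs with semi-edges and parallel edges, whose edges carry a color in
   {0, ..., n-1}: an edge is a pair {d, dinv d}, a semi-edge when dinv d = d. *)
Record cgraph (n : nat) := CGraph {
  flag : Type;
  dart : Type;
  init : dart -> flag;
  dinv : dart -> dart;
  color : dart -> 'I_n;
  dinvK : involutive dinv;
  color_dinv : forall d, color (dinv d) = color d
}.
Arguments init {n c} d.
Arguments dinv {n c} d.
Arguments color {n c} d.

Definition term n (G : cgraph n) (d : dart G) : flag G := init (dinv d).

(* [joined C x y]: some path from x to y uses only darts with color in C. *)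
Inductive joined n (G : cgraph n) (C : pred 'I_n) : flag G -> flag G -> Prop :=
| joined_refl x : joined C x x
| joined_step d y : C (color d) -> joined C (term d) y -> joined C (init d) y.

Definition connected n (G : cgraph n) : Prop :=
  inhabited (flag G) /\ forall x y : flag G, joined predT x y.

(* Loops d with dinv d <> d and term d = init d are excluded by the second
   clause, as the two darts of such an edge have the same color and origin. *)
Definition premaniplex n (G : cgraph n) : Prop :=
  [/\ connected G,
      forall (x : flag G) (i : 'I_n), exists! d : dart G, init d = x /\ color d = i
    & forall (i j : 'I_n) (d1 d2 d3 d4 : dart G), (i.+1 < j) || (j.+1 < i) ->
        color d1 = i -> color d2 = j -> color d3 = i -> color d4 = j ->
        term d1 = init d2 -> term d2 = init d3 -> term d3 = init d4 ->
        term d4 = init d1].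

Definition simple_graph n (G : cgraph n) : Prop :=
  (forall d : dart G, term d <> init d) /\
  (forall d d' : dart G, init d = init d' -> term d = term d' -> d = d').

Definition maniplex n (G : cgraph n) : Prop := premaniplex G /\ simple_graph G.

(* The color interval [k, m] is empty when m < k, in which case the two flags
   have to be equal. *)
Definition polytope n (G : cgraph n) : Prop :=
  maniplex G /\
  forall (k m : 'I_n) (x y : flag G),
    joined (fun i : 'I_n => i <= m) x y ->
    joined (fun i : 'I_n => k <= i) x y ->
    joined (fun i : 'I_n => k <= i <= m) x y.

(* r i x is the flag joined to x by its dart of color i; the default value x is
   never used in a premaniplex. *)
Definition r n (G : cgraph n) (i : 'I_n) (x : flag G) : flag G :=
  if pselect (exists d : dart G, init d = x /\ color d = i) is left e
  then term (sval (cid e)) else x.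

Definition face n (G : cgraph n) (i : nat) (x : flag G) : set (flag G) :=
  [set y | joined (fun j : 'I_n => j != i :> nat) x y].

Definition is_face n (G : cgraph n) (i : nat) (F : set (flag G)) : Prop :=
  exists x, F = face i x.

Section Isomorphisms.
Variable n : nat.

Record iso (G H : cgraph n) := Iso {
  iso_flag :> flag G -> flag H;
  iso_dart : dart G -> dart H;
  iso_flagV : flag H -> flag G;
  iso_dartV : dart H -> dart G;
  iso_flagK : cancel iso_flag iso_flagV;
  iso_flagVK : cancel iso_flagV iso_flag;
  iso_dartK : cancel iso_dart iso_dartV;
  iso_dartVK : cancel iso_dartV iso_dart;
  iso_init : forall d, init (iso_dart d) = iso_flag (init d);
  iso_dinv : forall d, dinv (iso_dart d) = iso_dart (dinv d);
  iso_color : forall d, color (iso_dart d) = color d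
}.

Lemma iso_eq (G H : cgraph n) (f g : iso G H) :
  iso_flag f =1 iso_flag g -> iso_dart f =1 iso_dart g -> f = g.
Proof.
move=> /funext E1 /funext E2.
have E3 : iso_flagV f = iso_flagV g.
  by apply/funext => y; rewrite -{1}(iso_flagVK g y) -E1 iso_flagK.
have E4 : iso_dartV f = iso_dartV g.
  by apply/funext => y; rewrite -{1}(iso_dartVK g y) -E2 iso_dartK.
case: f g E1 E2 E3 E4 => [a b c d ? ? ? ? ? ? ?] [a' b' c' d' ? ? ? ? ? ? ?] /=.
by move=> E1 E2 E3 E4; subst; f_equal.
Qed.

Program Definition iso_id (G : cgraph n) : iso G G :=
  @Iso G G id id id id _ _ _ _ _ _ _.
Solve All Obligations with by [].

Program Definition iso_comp (G H K : cgraph n) (f : iso G H) (g : iso H K) :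
    iso G K :=
  @Iso G K (g \o f) (iso_dart g \o iso_dart f)
    (iso_flagV f \o iso_flagV g) (iso_dartV f \o iso_dartV g) _ _ _ _ _ _ _.
Next Obligation. by move=> G H K f g x /=; rewrite !iso_flagK. Qed.
Next Obligation. by move=> G H K f g x /=; rewrite !iso_flagVK. Qed.
Next Obligation. by move=> G H K f g x /=; rewrite !iso_dartK. Qed.
Next Obligation. by move=> G H K f g x /=; rewrite !iso_dartVK. Qed.
Next Obligation. by move=> G H K f g d /=; rewrite !iso_init. Qed.
Next Obligation. by move=> G H K f g d /=; rewrite !iso_dinv. Qed.
Next Obligation. by move=> G H K f g d /=; rewrite !iso_color. Qed.

Program Definition iso_inv (G H : cgraph n) (f : iso G H) : iso H G :=
  @Iso H G (iso_flagV f) (iso_dartV f) f (iso_dart f) _ _ _ _ _ _ _.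
Next Obligation. by move=> G H f x; rewrite iso_flagVK. Qed.
Next Obligation. by move=> G H f x; rewrite iso_flagK. Qed.
Next Obligation. by move=> G H f x; rewrite iso_dartVK. Qed.
Next Obligation. by move=> G H f x; rewrite iso_dartK. Qed.
Next Obligation.
by move=> G H f d; rewrite -{2}(iso_dartVK f d) iso_init iso_flagK.
Qed.
Next Obligation.
by move=> G H f d; rewrite -{2}(iso_dartVK f d) iso_dinv iso_dartK.
Qed.
Next Obligation. by move=> G H f d; rewrite -{2}(iso_dartVK f d) iso_color. Qed.

Definition isomorphic (G H : cgraph n) : Prop := inhabited (iso G H).

Definition aut (G : cgraph n) : Type := iso G G.
Identity Coercion iso_of_aut : aut >-> iso.

HB.instance Definition _ (G : cgraph n) := gen_eqMixin (aut G).
HB.instance Definition _ (G : cgraph n) := gen_choiceMixin (aut G).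

Section AutGroup.
Variable G : cgraph n.
Implicit Types g h k : aut G.

(* Automorphisms act on the right: the flag written x g in the mathematical
   notation is [g x], and the product g * h applies g first. *)
Definition aut_one : aut G := iso_id G.
Definition aut_inv g : aut G := iso_inv g.
Definition aut_mul g h : aut G := iso_comp g h.

Lemma aut_mulA : associative aut_mul.
Proof. by move=> g h k; apply: iso_eq. Qed.
Lemma aut_mul1g : left_id aut_one aut_mul.
Proof. by move=> g; apply: iso_eq. Qed.
Lemma aut_mulg1 : right_id aut_one aut_mul.
Proof. by move=> g; apply: iso_eq. Qed.
Lemma aut_mulVg : left_inverse aut_one aut_inv aut_mul.
Proof. by move=> g; apply: iso_eq => x /=; rewrite ?iso_flagVK ?iso_dartVK. Qed.
Lemma aut_mulgV : right_inverse aut_one aut_inv aut_mul.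
Proof. by move=> g; apply: iso_eq => x /=; rewrite ?iso_flagK ?iso_dartK. Qed.

HB.instance Definition _ := isGroup.Build (aut G)
  aut_mulA aut_mul1g aut_mulg1 aut_mulVg aut_mulgV.

End AutGroup.

End Isomorphisms.

Definition regular n (G : cgraph n) : Prop :=
  forall x y : flag G, exists g : aut G, g x = y.

Definition face_transitive n (G : cgraph n) (i : nat) : Prop :=
  forall F F' : set (flag G), is_face i F -> is_face i F' ->
    exists g : aut G, g @` F = F'.

Definition vertex_transitive n (G : cgraph n) : Prop := face_transitive G 0.
Definition facet_transitive n (G : cgraph n) : Prop := face_transitive G n.-1.

Definition trivial_facet_stabilizer n (G : cgraph n) : Prop :=
  forall (F : set (flag G)) (g : aut G),
    is_face n.-1 F -> g @` F = F -> g = 1%g.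

Definition nondegenerate n (G : cgraph n) : Prop :=
  forall (i j : 'I_n) (x : flag G), j = i.+1 :> nat ->
    r i (r j (r i (r j x))) <> x.

Definition dual n (G : cgraph n) : cgraph n :=
  @CGraph n (flag G) (dart G) init dinv (fun d => rev_ord (color d))
    (@dinvK n G) (fun d => congr1 (@rev_ord n) (color_dinv d)).

Definition self_dual n (G : cgraph n) : Prop := isomorphic G (dual G).

(* r_{n-1} ... r_1 r_0, with r_0 applied first. *)
Definition petrie_step n (G : cgraph n) (x : flag G) : flag G :=
  foldl (fun y i => r i y) x (enum 'I_n).

Definition petrie_polygon n (G : cgraph n) (x : flag G) : set (flag G) :=
  [set y | exists k : nat,
     y = iter k (@petrie_step n G) x \/ x = iter k (@petrie_step n G) y].

Definition simple_petrie_polygons n (G : cgraph n) : Prop :=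
  forall x y z : flag G, petrie_polygon x y -> petrie_polygon x z -> y <> z ->
    face 0 y <> face 0 z.

(* The quotient by the automorphism group: flags and darts are the orbits of
   flags and darts.  In a maniplex, a dart orbit amounts to the orbit of a flag
   x together with a color i; its inverse is that of r i x, so that it is a
   semi-edge exactly when x and r i x are in the same orbit. *)
Section SymmetryTypeGraph.
Variables (n : nat) (G : cgraph n).

Definition flag_orbit (x : flag G) : set (flag G) :=
  [set y | exists g : aut G, y = g x].
Definition dart_orbit (d : dart G) : set (dart G) :=
  [set e | exists g : aut G, e = iso_dart g d].

Definition flag_orbits : Type := {A : set (flag G) | exists x, A = flag_orbit x}.
Definition dart_orbits : Type := {A : set (dart G) | exists d, A = dart_orbit d}.

Lemma init_orbit d : init @` dart_orbit d = flag_orbit (init d).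
Proof.
apply/seteqP; split=> [_ [_ [g ->] <-]|_ [g ->]]; first by exists g; rewrite iso_init.
by exists (iso_dart g d); [exists g | rewrite iso_init].
Qed.

Lemma dinv_orbit d : dinv @` dart_orbit d = dart_orbit (dinv d).
Proof.
apply/seteqP; split=> [_ [_ [g ->] <-]|_ [g ->]]; first by exists g; rewrite iso_dinv.
by exists (iso_dart g d); [exists g | rewrite iso_dinv].
Qed.

Lemma stg_init_subproof (O : dart_orbits) :
  exists x, init @` sval O = flag_orbit x.
Proof. by case: O => A [d EA]; exists (init d); rewrite /= EA; apply: init_orbit. Qed.

Lemma stg_dinv_subproof (O : dart_orbits) :
  exists d, dinv @` sval O = dart_orbit d.
Proof. by case: O => A [d EA]; exists (dinv d); rewrite /= EA; apply: dinv_orbit. Qed.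

Definition stg_init (O : dart_orbits) : flag_orbits :=
  exist _ (init @` sval O) (stg_init_subproof O).
Definition stg_dinv (O : dart_orbits) : dart_orbits :=
  exist _ (dinv @` sval O) (stg_dinv_subproof O).

(* The common color of the darts of the orbit, see [stg_colorE]. *)
Definition stg_color (O : dart_orbits) : 'I_n := color (sval (cid (svalP O))).

Lemma stg_colorE (O : dart_orbits) d : sval O d -> stg_color O = color d.
Proof.
rewrite /stg_color; case: (cid _) => /= e ->.
by move=> [g ->]; rewrite iso_color.
Qed.

Lemma stg_dinvK : involutive stg_dinv.
Proof.
move=> [A HA]; apply: eq_exist => /=; apply/seteqP; split.
  by move=> _ [_ [d Ad <-] <-]; rewrite dinvK.
by move=> d Ad; exists (dinv d); [exists d | rewrite dinvK].
Qed.

Lemma stg_color_dinv O : stg_color (stg_dinv O) = stg_color O.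
Proof.
have [d Od] : exists d, sval O d.
  by case: O => A [d EA]; exists d; rewrite /= EA; exists 1%g.
rewrite (stg_colorE Od) (@stg_colorE _ (dinv d)) ?color_dinv //.
by exists d.
Qed.

Definition symmetry_type_graph : cgraph n :=
  CGraph stg_init stg_dinvK stg_color_dinv.

End SymmetryTypeGraph.

Record voltage n (X : cgraph n) (Gamma : groupType) := Voltage {
  volt :> dart X -> Gamma;
  volt_dinv : forall d, volt (dinv d) = ((volt d)^-1)%g
}.

Section DerivedGraph.
Variables (n : nat) (X : cgraph n) (Gamma : groupType) (xi : voltage X Gamma).

Definition derived_init (e : dart X * Gamma) : flag X * Gamma := (init e.1, e.2).
Definition derived_dinv (e : dart X * Gamma) : dart X * Gamma :=
  (dinv e.1, (xi e.1 * e.2)%g).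

Lemma derived_dinvK : involutive derived_dinv.
Proof.
by move=> [d g]; rewrite /derived_dinv /= dinvK volt_dinv mulgA mulVg mul1g.
Qed.

Definition derived : cgraph n :=
  @CGraph n (flag X * Gamma) (dart X * Gamma) derived_init derived_dinv
    (fun e => color e.1) derived_dinvK (fun e => color_dinv e.1).

Lemma derived_term (d : dart X) (g : Gamma) :
  @term n derived (d, g) = (term d, (xi d * g)%g).
Proof. by []. Qed.

End DerivedGraph.

(* The flags of the n-gon are coded by pairs: with y0 = (0, false), the flag
   (r_1 r_0)^i y0 is (i, false) and r_0 (r_1 r_0)^i y0 is (i, true); see
   [family1_edgeE].  The colors 0 and 2 both exchange the two flags of each
   1-face e_i, and there is one dart (y, c) for each flag y and color c. *)
Section Family1.
Variable n : nat.

Definition gon_flag : Type := ('I_n * bool)%type.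

Definition gon_r0 (y : gon_flag) : gon_flag := (y.1, ~~ y.2).
Definition gon_r1 (y : gon_flag) : gon_flag :=
  if y.2 then (ordS y.1, false) else (ord_pred y.1, true).

Definition family1_r (c : 'I_3) : gon_flag -> gon_flag :=
  if c == 1 :> nat then gon_r1 else gon_r0.

Lemma family1_rK c : involutive (family1_r c).
Proof.
rewrite /family1_r; case: ifP => _ [i []];
  by rewrite /gon_r0 /gon_r1 /= ?ordSK ?ord_predK.
Qed.

Definition family1_dinv (d : gon_flag * 'I_3) : gon_flag * 'I_3 :=
  (family1_r d.2 d.1, d.2).

Lemma family1_dinvK : involutive family1_dinv.
Proof. by move=> [y c]; rewrite /family1_dinv /= family1_rK. Qed.

Definition family1 : cgraph 3 :=
  @CGraph 3 gon_flag (gon_flag * 'I_3) fst family1_dinv snd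
    family1_dinvK (fun _ => erefl).

Definition family1_edge (i : 'I_n) : set (flag family1) :=
  [set (i, false); (i, true)].

End Family1.

Lemma family1_edgeE n (i : 'I_n.+1) :
  let y := iter i (@gon_r1 n.+1 \o @gon_r0 n.+1) (ord0, false) in
  @family1_edge n.+1 i = [set y; gon_r0 y].
Proof.
suff -> : iter i (@gon_r1 n.+1 \o @gon_r0 n.+1) (ord0, false) = (i, false) by [].
case: i => k; elim: k => [|k IH] lt_k /=; first by congr pair; apply: val_inj.
rewrite (IH (ltnW lt_k)) /gon_r1 /gon_r0 /=; congr pair.
by apply: val_inj; rewrite /= modn_small.
Qed.

(* Main.v *)
(** Through g |-> g Phi, the flags of the derived graph become pairs (y, x) of a
    flag y of the n-gon and a flag x of P, where a dart of color 2 over e_i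
    moves x to r_i x. The facets are the copies of the n-gon, one for each flag
    of P, and a vertex traces a Petrie polygon of P; two flags of the derived
    graph on a common facet and a common vertex then give two flags of one
    Petrie polygon on a common vertex, which are equal by simplicity.

    An automorphism of the derived graph acts on all copies of the n-gon by the
    same dihedral symmetry, and the induced permutation of the generators
    preserves the relations of the group of P. Since r_0 and r_{n-1} are the
    only cyclically adjacent generators that commute, a non-trivial symmetry
    would be a self-duality of P. The case n <= 2 is void because P is then
    self-dual. *)

Require Import Defs.
From HB Require Import structures.
From mathcomp Require Import all_boot all_classical.

Set Implicit Arguments.
Unset Strict Implicit.
Unset Printing Implicit Defensive.

Local Open Scope classical_set_scope.

(** * Paths, faces and automorphisms of colored graphs *)

Section Joined.
Variables (n : nat) (G : cgraph n).
Implicit Types (x y z : flag G) (C : pred 'I_n).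

Lemma joined_trans C x y z : joined C x y -> joined C y z -> joined C x z.
Proof. by elim=> // d {}y Cd _ IH /IH; apply: joined_step. Qed.

Lemma joined_dart C (d : dart G) : C (color d) -> joined C (init d) (term d).
Proof. by move=> Cd; apply: joined_step => //; apply: joined_refl. Qed.

Lemma joined_sym C x y : joined C x y -> joined C y x.
Proof.
elim=> [z|d {}y Cd _ IH]; first exact: joined_refl.
apply: joined_trans IH _; rewrite -[d in X in joined _ _ X]dinvK.
by apply: (@joined_dart C (dinv d)); rewrite color_dinv.
Qed.

Lemma joined_sub C C' x y : {subset C <= C'} -> joined C x y -> joined C' x y.
Proof.
move=> sub; elim=> [z|d {}y Cd _ IH]; first exact: joined_refl.
by apply: joined_step IH; apply: sub.
Qed.

Lemma joined_invariant (Q : flag G -> Prop) C x y :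
    (forall d, C (color d) -> Q (init d) -> Q (term d)) ->
  joined C x y -> Q x -> Q y.
Proof. by move=> step; elim=> // d {}y Cd _ IH /(step d Cd). Qed.

Lemma eq_face (i : nat) x y :
  joined (fun j : 'I_n => j != i :> nat) x y -> face i x = face i y.
Proof.
move=> xy; apply/seteqP; split=> z; last exact: joined_trans.
exact/joined_trans/joined_sym.
Qed.

Lemma face_refl (i : nat) x : face i x x.
Proof. exact: joined_refl. Qed.

Lemma iso_term (g : aut G) d : term (iso_dart g d) = g (term d).
Proof. by rewrite /term iso_dinv iso_init. Qed.

Lemma iso_joined (g : aut G) C x y : joined C x y -> joined C (g x) (g y).
Proof.
elim=> [z|d {}y Cd _ IH]; first exact: joined_refl.
by rewrite -iso_init; apply: joined_step; rewrite ?iso_color ?iso_term.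
Qed.

Lemma autVK (g : aut G) : cancel (g^-1)%g g.
Proof. exact: iso_flagVK. Qed.

Lemma iso_face (g : aut G) (i : nat) x : g @` face i x = face i (g x).
Proof.
apply/seteqP; split=> [_ [y xy <-]|y xy]; first exact: iso_joined.
exists ((g^-1)%g y); last exact: autVK.
by rewrite -[x](iso_flagK g); apply: (@iso_joined (g^-1)%g).
Qed.

Lemma flag_orbit_aut (g : aut G) x : flag_orbit (g x) = flag_orbit x.
Proof.
apply/seteqP; split=> _ [h ->]; first by exists (g * h)%g.
by exists (g^-1 * h)%g; rewrite /= iso_flagK.
Qed.

Lemma dart_orbit_aut (g : aut G) d : dart_orbit (iso_dart g d) = dart_orbit d.
Proof.
apply/seteqP; split=> _ [h ->]; first by exists (g * h)%g.
by exists (g^-1 * h)%g; rewrite /= iso_dartK.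
Qed.

End Joined.

(** * Color words acting on the flags of a premaniplex *)

Section Walk.
Variables (n : nat) (G : cgraph n).
Implicit Types (x y z : flag G) (i j : 'I_n) (w : seq 'I_n).

Definition walk x w : flag G := foldl (fun y i => r i y) x w.

Lemma walk_cat x w w' : walk x (w ++ w') = walk (walk x w) w'.
Proof. exact: foldl_cat. Qed.

Lemma walk_rcons x w i : walk x (rcons w i) = r i (walk x w).
Proof. exact: foldl_rcons. Qed.

Hypothesis G_pre : premaniplex G.

Lemma dart_unique (d d' : dart G) : init d = init d' -> color d = color d' -> d = d'.
Proof.
case: G_pre => _ uniq _ E1 E2; have [d0 [_ U]] := uniq (init d') (color d').
by rewrite -(U d) // -(U d').
Qed.

Lemma dartP x i : exists d : dart G, init d = x /\ color d = i.
Proof. by case: G_pre => _ uniq _; have [d [Ed _]] := uniq x i; exists d. Qed.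

Lemma term_r (d : dart G) : term d = r (color d) (init d).
Proof.
rewrite /r; case: pselect => [e|[]]; last by exists d.
by case: (cid e) => d' [E1 E2] /=; congr term; apply: dart_unique.
Qed.

Lemma rK i : involutive (@r n G i).
Proof.
move=> x; have [d [<- <-]] := dartP x i.
by rewrite -term_r -{1}(color_dinv d) -(term_r (dinv d)) /term dinvK.
Qed.

Lemma joined_r (C : pred 'I_n) x i : C i -> joined C x (r i x).
Proof. by have [d [<- <-]] := dartP x i; rewrite -term_r; apply: joined_dart. Qed.

Lemma joined_walk (C : pred 'I_n) x w : all C w -> joined C x (walk x w).
Proof.
elim: w x => [|i w IH] x /=; first by move=> _; apply: joined_refl.
by case/andP=> Ci /(IH (r i x)); apply: joined_trans (joined_r _ Ci).
Qed.

Lemma walk_connected x y : exists w, y = walk x w.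
Proof.
have : joined predT x y by case: G_pre => -[_].
elim=> [z|d z _ _ [w ->]]; first by exists [::].
by exists (color d :: w); rewrite term_r.
Qed.

Lemma walk_rev x w : walk (walk x w) (rev w) = x.
Proof. by elim: w x => //= i w IH x; rewrite rev_cons walk_rcons IH rK. Qed.

Lemma walk_inj w : injective (walk^~ w).
Proof. by move=> x y; elim: w x y => //= i w IH x y /IH /(can_inj (rK i)). Qed.

Lemma r_comm i j x : (i.+1 < j) || (j.+1 < i) -> walk x [:: i; j; i; j] = x.
Proof.
move=> ij; case: G_pre => _ _ close /=.
have [d1 [E1 C1]] := dartP x i.
have [d2 [E2 C2]] := dartP (term d1) j.
have [d3 [E3 C3]] := dartP (term d2) i.
have [d4 [E4 C4]] := dartP (term d3) j.
rewrite -E1 -[in RHS](close i j d1 d2 d3 d4 ij C1 C2 C3 C4) //.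
by rewrite term_r C4 E4 term_r C3 E3 term_r C2 E2 term_r C1.
Qed.

Lemma aut_r (g : aut G) i x : g (r i x) = r i (g x).
Proof.
have [d [<- <-]] := dartP x i.
by rewrite -term_r -iso_term term_r iso_color iso_init.
Qed.

Lemma aut_walk (g : aut G) x w : g (walk x w) = walk (g x) w.
Proof. by elim: w x => //= i w IH x; rewrite IH aut_r. Qed.

(** Automorphisms commute with walks, and walks from one flag reach all flags. *)
Lemma aut_eq (g h : aut G) x : g x = h x -> g = h.
Proof.
move=> gh; have E : g =1 h.
  by move=> y; have [w ->] := walk_connected x y; rewrite !aut_walk gh.
apply: iso_eq => // d; apply: dart_unique; last by rewrite !iso_color.
by rewrite !iso_init E.
Qed.

Lemma r_neq i x : simple_graph G -> r i x <> x.
Proof. by case=> loopless _; have [d [<- <-]] := dartP x i; rewrite -term_r. Qed.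

End Walk.

(** * Self-duality, in particular in ranks at most 2 *)

Section SelfDual.
Variables (n : nat) (G : cgraph n).
Hypothesis G_pre : premaniplex G.

(** The closed words at [x0] decide which words lead to the same flag, so reversing the colors of
    words descends to an involution of the flags, which is an isomorphism onto the dual. *)
Lemma self_dual_walk (x0 : flag G) :
    (forall w, walk x0 w = x0 -> walk x0 (map (@rev_ord n) w) = x0) ->
  self_dual G.
Proof.
move=> swap.
have swap_eq w w' : walk x0 w = walk x0 w' ->
    walk x0 (map (@rev_ord n) w) = walk x0 (map (@rev_ord n) w').
  move=> E; have := swap (w ++ rev w').
  rewrite walk_cat E walk_rev // map_cat walk_cat map_rev => /(_ erefl) E'.
  by apply: (walk_inj G_pre (w := rev (map (@rev_ord n) w'))); rewrite E' walk_rev.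
have word x : {w | x = walk x0 w} by apply/cid/walk_connected.
pose h x := walk x0 (map (@rev_ord n) (sval (word x))).
have hw w : h (walk x0 w) = walk x0 (map (@rev_ord n) w).
  by rewrite /h; case: (word _) => w' /= E; apply: swap_eq.
have hK : involutive h.
  move=> x; have [w ->] := walk_connected G_pre x0 x.
  by rewrite !hw -map_comp map_id_in // => i _; rewrite /= rev_ordK.
have hr i x : h (r i x) = r (rev_ord i) (h x).
  have [w ->] := walk_connected G_pre x0 x.
  by rewrite -walk_rcons !hw map_rcons walk_rcons.
have dartX (d : dart G) :
  {e : dart G | init e = h (init d) /\ color e = rev_ord (color d)}.
  exact/cid/dartP.
pose hd d := sval (dartX d).
have hd_init d : init (hd d) = h (init d) by rewrite /hd; case: (dartX d) => e [].
have hd_color d : color (hd d) = rev_ord (color d).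
  by rewrite /hd; case: (dartX d) => e [].
have hdK : involutive hd.
  move=> d; apply: (dart_unique G_pre); first by rewrite !hd_init hK.
  by rewrite !hd_color rev_ordK.
constructor; apply: (@Iso n G (dual G) h hd h hd) => // d.
- apply: (dart_unique G_pre); last by rewrite color_dinv !hd_color color_dinv.
  rewrite hd_init -[init (dinv (hd d))]/(term (hd d)) -[init (dinv d)]/(term d).
  by rewrite !term_r // hr hd_init hd_color.
- by rewrite /= hd_color rev_ordK.
Qed.

End SelfDual.

Lemma self_dual_small n (G : cgraph n) : n < 2 -> premaniplex G -> self_dual G.
Proof.
move=> n_lt2 G_pre; case: (G_pre) => -[[x0] _] _ _.
apply: (self_dual_walk G_pre (x0 := x0)) => w; rewrite map_id_in // => i _.
by apply: val_inj; case: i => i; case: n n_lt2 {G G_pre x0 w} => [|[|]] //=; case: i.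
Qed.

Section Polygon.

Fixpoint alternating (i : 'I_2) (m : nat) : seq 'I_2 :=
  if m is m'.+1 then i :: alternating (rev_ord i) m' else [::].

Lemma alternating_rcons i m :
  alternating i m.+1 = rcons (alternating i m) (iter m (@rev_ord 2) i).
Proof.
elim: m i => // m IH i.
by rewrite [LHS]/= -[_ :: alternating _ _]/(alternating _ m.+1) IH iterSr.
Qed.

Lemma iter_rev_ord2 i k : iter k.*2 (@rev_ord 2) i = i.
Proof. by elim: k => //= k ->; rewrite rev_ordK. Qed.

Lemma rev_alternating i k : rev (alternating i k.*2) = alternating (rev_ord i) k.*2.
Proof.
elim: k i => // k IH i; rewrite doubleS.
by rewrite 2!alternating_rcons !rev_rcons IH iterS iter_rev_ord2 /= rev_ordK.
Qed.

Lemma ord2_cases (i j : 'I_2) : j = i \/ j = rev_ord i.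
Proof.
move: i j => [[|[|m]] lt_i] // [[|[|k]] lt_j] //; [left|right|right|left];
  exact: val_inj.
Qed.

Variable G : cgraph 2.
Hypothesis G_pre : premaniplex G.

(** Equal consecutive letters cancel, and the same cancellations occur once the two colors are
    exchanged; hence the common length [m]. *)
Lemma walk_alternating w : exists i m, forall x : flag G,
  walk x w = walk x (alternating i m) /\
  walk x (map (@rev_ord 2) w) = walk x (alternating (rev_ord i) m).
Proof.
elim: w => [|j w [i [m IH]]]; first by exists ord0, 0.
have [->|->] := ord2_cases i j; last first.
  by exists (rev_ord i), m.+1 => x /=; rewrite !rev_ordK; apply: conj; apply IH.
case: m IH => [|m] IH; first by exists i, 1 => x /=; split; apply IH.
exists (rev_ord i), m => x /=; split.
- by have [-> _] := IH (r i x); rewrite /= rK.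
- by have [_ ->] := IH (r (rev_ord i) x); rewrite /= rK.
Qed.

(** Read backwards, an alternating word of even length is its own color swap. One of odd length is
    conjugate to a single letter, which fixes no flag of a simple graph. *)
Lemma polygon_self_dual : simple_graph G -> self_dual G.
Proof.
move=> simple; case: (G_pre) => -[[x0] _] _ _.
apply: (self_dual_walk G_pre (x0 := x0)) => w.
have [i [m /(_ x0) [-> ->]]] := walk_alternating w.
rewrite -(odd_double_half m); case: (odd m); last first.
  by rewrite add0n => E; rewrite -rev_alternating -{1}E walk_rev.
rewrite add1n => E; exfalso; move: E.
elim: (m./2) i x0 => [|k IH] i x; first exact: r_neq.
rewrite alternating_rcons iter_rev_ord2 walk_rcons doubleS => E.
by apply: (IH (rev_ord i) (r i x)); rewrite -{2}E rK.
Qed.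

End Polygon.

(** * Petrie polygons of a polytope *)

Lemma drop_enum_ord n (i : 'I_n) : drop i (enum 'I_n) = i :: drop i.+1 (enum 'I_n).
Proof. by rewrite (drop_nth i) ?size_enum_ord // nth_ord_enum. Qed.

Lemma mem_drop_enum_ord n k (i : 'I_n) : i \in drop k (enum 'I_n) -> k <= i.
Proof.
move=> /(map_f val); rewrite map_drop val_enum_ord drop_iota mem_iota.
by case/andP.
Qed.

Section Petrie.
Variables (n : nat) (G : cgraph n.+1).
Implicit Types (x y z : flag G) (p q i : 'I_n.+1).
Hypothesis G_polytope : polytope G.

Let G_pre : premaniplex G. Proof. by case: G_polytope => -[]. Qed.

(** Otherwise [r i x] and [x] are joined by colors at most [i] and also by colors at least [i + 1];
    the polytope property over this empty interval forces [r i x = x]. *)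
Lemma walk_increasing_neq i (w : seq 'I_n.+1) x :
  all (fun j : 'I_n.+1 => i < j) w -> walk (r i x) w <> x.
Proof.
have neq : r i x <> x by apply: r_neq => //; case: G_polytope => -[].
case: w => [|j w] // lt_w Ex.
have lt_i : i.+1 < n.+1 by case/andP: (lt_w) => /leq_ltn_trans -> //.
pose k : 'I_n.+1 := Ordinal lt_i.
have up : joined (fun a : 'I_n.+1 => k <= a) (r i x) x.
  by rewrite -{2}Ex; apply: joined_walk.
have down : joined (fun a : 'I_n.+1 => a <= i) (r i x) x.
  by apply/joined_sym/joined_r.
case: G_polytope => _ /(_ _ _ _ _ down up) H.
apply/neq; apply: (joined_invariant (Q := eq (r i x)) _ H) => // d /=.
by case/andP=> /leq_trans /[apply]; rewrite ltnn.
Qed.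

Lemma petrie_step_inj : injective (@petrie_step n.+1 G).
Proof. exact: walk_inj. Qed.

Lemma petrie_polygon_step x y :
  petrie_polygon x y <-> petrie_polygon x (petrie_step y).
Proof.
split=> -[k [E|E]].
- by exists k.+1; left; rewrite E.
- case: k E => [|k] E; first by exists 1; left; move: E => /= ->.
  by exists k; right; rewrite E iterSr.
- case: k E => [|k] E; first by exists 1; right; move: E => /= <-.
  by exists k; left; apply: petrie_step_inj; rewrite E.
- by exists k.+1; right; rewrite E iterSr.
Qed.

(** Completes a round [r_0, ..., r_n] of the Petrie walk in which [p] was the last color applied. *)
Definition petrie_flag p x : flag G := walk x (drop p.+1 (enum 'I_n.+1)).

Lemma petrie_flag_face p x : face 0 (petrie_flag p x) = face 0 x.
Proof.
apply/esym/eq_face/joined_walk => //.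
by apply/allP => i /mem_drop_enum_ord; case: (nat_of_ord i).
Qed.

(** The next color is the first step of the completion, unless [p] is the last color: then it opens
    a full new round. *)
Lemma petrie_flag_ordS p x :
  petrie_flag (ordS p) (r (ordS p) x) = petrie_flag p x \/
  petrie_flag (ordS p) (r (ordS p) x) = petrie_step (petrie_flag p x).
Proof.
rewrite -[_ _ (r _ x)]/(walk x (ordS p :: _)) -drop_enum_ord /= /petrie_flag.
have [lt_p|ge_p] := ltnP p n; first by left; rewrite modn_small.
right; have -> : p = n :> nat by apply/anti_leq; rewrite ge_p -ltnS ltn_ord.
by rewrite modnn drop0 drop_oversize ?size_enum_ord.
Qed.

(** For [p < q] the colors above [q] cancel, and those from [p + 1] to [q] would form an increasing
    closed walk. *)
Lemma petrie_flag_inj p q x : petrie_flag p x = petrie_flag q x -> p = q.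
Proof.
wlog lt_pq : p q / p < q => [sym E|].
  case: (ltngtP p q) => [/sym|/sym H|/val_inj] //; first exact.
  exact/esym/H.
have lt_p : p.+1 < n.+1 by exact: leq_ltn_trans lt_pq (ltn_ord q).
rewrite /petrie_flag -(cat_take_drop (q - p) (drop p.+1 _)) drop_drop addnS.
rewrite subnK ?(ltnW lt_pq) // walk_cat => /(walk_inj G_pre).
rewrite -[p.+1]/(val (Ordinal lt_p)) drop_enum_ord -(subnSK lt_pq) /=.
case/walk_increasing_neq; apply/allP => j /mem_take /mem_drop_enum_ord.
exact.
Qed.

Hypothesis G_petrie : simple_petrie_polygons G.

(** Only positive colors are applied to [x], so both flags lie in its vertex, and simplicity makes
    them equal. *)
Lemma petrie_flag_inj_polygon p q x :
  petrie_polygon (petrie_flag p x) (petrie_flag q x) -> p = q.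
Proof.
move=> pq; apply: (@petrie_flag_inj p q x); apply: contrapT => neq.
have pp : petrie_polygon (petrie_flag p x) (petrie_flag p x) by exists 0; left.
by apply: (G_petrie pp pq neq); rewrite !petrie_flag_face.
Qed.

End Petrie.

(** * Moves and equivariant maps of the n-gon *)

Section Gon.
Variable n : nat.
Implicit Types y z : gon_flag n.+1.

(** The two moves are involutions that connect the cycle, so a property closed under both is
    constant on it. *)
Lemma gon_ind (Q : gon_flag n.+1 -> Prop) y :
    (forall z, Q z -> Q (gon_r0 z)) -> (forall z, Q z -> Q (gon_r1 z)) ->
  Q y -> forall z, Q z.
Proof.
move=> Q0 Q1; pose y0 : gon_flag n.+1 := (ord0, false).
have flip i b : Q (i, b) <-> Q (i, ~~ b).
  by split=> /Q0 //; rewrite /gon_r0 /= negbK.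
have side i b : Q (i, b) <-> Q (i, false) by case: b => //; apply: (flip i true).
suff base i : Q (i, false) <-> Q y0.
  by case: y => i b /side/base Qy0 [j c]; apply/side/base.
case: i; elim=> [|k IH] lt_k.
  by rewrite (_ : Ordinal lt_k = ord0) //; apply: val_inj.
rewrite -(IH (ltnW lt_k)).
have E : Ordinal lt_k = ordS (Ordinal (ltnW lt_k)).
  by apply: val_inj; rewrite /= modn_small.
split=> [/Q1|/flip/Q1]; rewrite /gon_r1 /= ?E // ordSK.
by move/flip.
Qed.

Lemma gon_map_eq (f h : gon_flag n.+1 -> gon_flag n.+1) y :
    (forall z, f (gon_r0 z) = gon_r0 (f z)) -> (forall z, f (gon_r1 z) = gon_r1 (f z)) ->
    (forall z, h (gon_r0 z) = gon_r0 (h z)) -> (forall z, h (gon_r1 z) = gon_r1 (h z)) ->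
  f y = h y -> f =1 h.
Proof.
move=> f0 f1 h0 h1 E; apply: (gon_ind _ _ E) => z Ez.
- by rewrite f0 h0 Ez.
- by rewrite f1 h1 Ez.
Qed.

End Gon.

(** * The derived graph is a simple premaniplex *)

Section Derived.
Variables (N : nat) (P : cgraph N.+2).
Notation n := N.+2.
Hypothesis P_polytope : polytope P.
Variables (Phi : flag P) (rho : 'I_n -> aut P).
Hypothesis rho_spec : forall i : 'I_n, rho i Phi = r i Phi.
Variable xi : voltage (family1 n) (aut P).
Hypothesis xi01 : forall d : dart (family1 n), color d < 2 -> xi d = 1%g.
Hypothesis xi2 : forall (i : 'I_n) (d : dart (family1 n)),
  color d = 2 :> nat -> family1_edge i (init d) -> xi d = rho i.

Implicit Types (y z : gon_flag n) (g h : aut P) (i j : 'I_n) (c : 'I_3).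

Local Notation D := (derived xi).
Local Notation c0 := (ord0 : 'I_3).
Local Notation c1 := (Ordinal (erefl (1 < 3))).
Local Notation c2 := (Ordinal (erefl (2 < 3))).

Let P_pre : premaniplex P. Proof. by case: P_polytope => -[]. Qed.
Let P_simple : simple_graph P. Proof. by case: P_polytope => -[]. Qed.

(** Products apply [rho i] first and [g] commutes with [r i], so multiplying by the voltage [rho i]
    on the left is a move in [P]. *)
Lemma rho_mul i g : (rho i * g)%g Phi = r i (g Phi).
Proof. by rewrite -aut_r // -rho_spec. Qed.

Lemma aut_eq_base g h : g Phi = h Phi -> g = h.
Proof. exact: aut_eq. Qed.

Lemma rho_invol i g : (rho i * (rho i * g))%g = g.
Proof. by apply: aut_eq_base; rewrite !rho_mul rK. Qed.

Lemma rho_neq i g : (rho i * g)%g <> g.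
Proof.
move=> E; apply: (r_neq P_pre (i := i) (x := g Phi) P_simple).
by rewrite -rho_mul E.
Qed.

Lemma voltE y c : xi (y, c) = if c == 2 :> nat then rho y.1 else 1%g.
Proof.
case: eqP => [c_2|]; last by case: c => [[|[|[|]]]] //= ? _; apply: xi01.
by apply: xi2 => //; case: y => i []; [right|left].
Qed.

Lemma derived_joined (C : pred 'I_3) y c g :
  C c -> @joined _ D C (y, g) (family1_r c y, (xi (y, c) * g)%g).
Proof. exact: (@joined_dart _ D C ((y, c), g)). Qed.

Lemma derived_step0 (C : pred 'I_3) y g : C c0 -> @joined _ D C (y, g) (gon_r0 y, g).
Proof. by move=> /(derived_joined y g); rewrite voltE mul1g. Qed.

Lemma derived_step1 (C : pred 'I_3) y g : C c1 -> @joined _ D C (y, g) (gon_r1 y, g).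
Proof. by move=> /(derived_joined y g); rewrite voltE mul1g. Qed.

Lemma derived_step2 (C : pred 'I_3) y g :
  C c2 -> @joined _ D C (y, g) (gon_r0 y, (rho y.1 * g)%g).
Proof. by move=> /(derived_joined y g); rewrite voltE. Qed.

Lemma derived_same_facet (C : pred 'I_3) y z g :
  C c0 -> C c1 -> @joined _ D C (y, g) (z, g).
Proof.
move=> C0 C1; apply: (gon_ind (Q := fun z => @joined _ D C (y, g) (z, g)) (y := y)).
- by move=> {}z /joined_trans; apply; apply: derived_step0.
- by move=> {}z /joined_trans; apply; apply: derived_step1.
- exact: joined_refl.
Qed.

(** Each letter [i] of a word from [g Phi] to [h Phi] lifts to a move to side [i] inside the current
    copy of the n-gon, then a crossing with color 2. *)
Lemma derived_connected : connected D.
Proof.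
split; first by constructor; exact: ((ord0, false), 1%g).
move=> [y g] [z h]; have [w] := walk_connected P_pre (g Phi) (h Phi).
elim: w y g => [|i w IH] y g /=.
  by move=> /aut_eq_base ->; apply: derived_same_facet.
rewrite -rho_mul => /(IH (i, true)); apply: joined_trans.
apply: (@joined_trans _ D _ _ ((i, false), g)); first exact: derived_same_facet.
exact: (@derived_step2 _ (i, false)).
Qed.

Lemma derived_premaniplex : premaniplex D.
Proof.
split; first exact: derived_connected.
  move=> [y g] c; exists ((y, c), g); split=> //.
  by case=> -[y' c'] g' [/= [-> ->] ->].
move=> i j [[y1 c_1] g1] [[y2 c_2] g2] [[y3 c_3] g3] [[y4 c_4] g4] ij.
rewrite !derived_term /= => -> -> -> -> {c_1 c_2 c_3 c_4}.
rewrite /term /derived_init /family1_dinv /= => -[<- <-] -[<- <-] -[<- <-].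
clear y2 y3 y4 g2 g3 g4.
(* The only distant colors are 0 and 2. Both stay on one side of the n-gon, so the two color-2 steps
   use the same [rho], an involution. *)
have [i1 j1 ij2] : [/\ i != 1 :> nat, j != 1 :> nat & (i == 2 :> nat) = (j != 2 :> nat)].
  by case: i j ij => [[|[|[|]]]] // ? [[|[|[|]]]].
rewrite !voltE /family1_r (negPf i1) (negPf j1) ij2 /=.
by case: eqP => _ /=; rewrite ?mul1g rho_invol /gon_r0 /= !negbK; case: y1.
Qed.

Lemma ord_pred_neq i : ord_pred i <> i.
Proof.
move=> /(congr1 (@ordS _)); rewrite ord_predK => /(congr1 val) /=.
have [lt_i|le_i] := ltnP i.+1 n; first by rewrite modn_small // => /n_Sn.
have -> : i = N.+1 :> nat by apply/anti_leq; rewrite -ltnS ltn_ord.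
by rewrite modnn.
Qed.

Lemma ordS_neq i : ordS i <> i.
Proof. by move=> E; apply: (@ord_pred_neq i); rewrite -{1}E ordSK. Qed.

Lemma gon_r1_edge y : (gon_r1 y).1 <> y.1.
Proof. by case: y => i []; [apply: ordS_neq|apply: ord_pred_neq]. Qed.

(** Every move flips the boolean, which excludes loops. Color 1 changes the side, unlike 0 and 2; of
    these, only color 2 changes the group component. *)
Lemma derived_simple : simple_graph D.
Proof.
split=> [[[y c] g]|[[y c] g] [[y' c'] g']].
  rewrite derived_term => -[/= E _]; case: y E => i b.
  rewrite /term /= /family1_r; case: ifP => _; rewrite /gon_r0 /gon_r1 /=.
    by case: b.
  by case=> /esym; case: b.
rewrite !derived_term => -[<- <-] E {y' g'}; have /= E1 := congr1 fst E.
have {E} E2 := congr1 snd E; rewrite !voltE /= in E2.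
move: E1; rewrite /term /= /family1_r => E1; suff -> : c = c' by [].
move: E1 E2; case: c c' => [[|[|[|c]]] lt_c] // [[|[|[|c']]] lt_c'] //= E1 E2;
  try exact: val_inj.
all: try by case: (@gon_r1_edge y); first [exact: (congr1 fst E1)
                                        | exact: (esym (congr1 fst E1))].
- by case: (@rho_neq y.1 g); apply: etrans (esym E2) (mul1g g).
- by case: (@rho_neq y.1 g); apply: etrans E2 (mul1g g).
Qed.

Lemma derived_r y c g :
  r c ((y, g) : flag D) = (family1_r c y, (xi (y, c) * g)%g).
Proof.
exact/esym/(term_r derived_premaniplex ((y, c), g) : term (_ : dart D) = _).
Qed.

(** * Vertices as Petrie polygons, and the polytope property *)

(** Vertex [i] of the n-gon is the one between the sides [i] and [ordS i]. *)
Definition gon_vertex y : 'I_n := if y.2 then y.1 else ord_pred y.1.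

Lemma gon_vertex_r1 y : gon_vertex (gon_r1 y) = gon_vertex y.
Proof. by case: y => i []; rewrite /gon_vertex /gon_r1 /= ?ordSK. Qed.

Lemma gon_vertex_inj y z : gon_vertex y = gon_vertex z -> z = y \/ z = gon_r1 y.
Proof.
case: y z => i [] [j []]; rewrite /gon_vertex /gon_r1 /= => E.
- by left; rewrite E.
- by right; rewrite E ord_predK.
- by right; rewrite E.
- by left; rewrite (can_inj (@ord_predK _) E).
Qed.

Hypothesis P_petrie : simple_petrie_polygons P.

(* The vertices of the derived graph are Petrie polygons of [P]: walking around
   a vertex with r_1 and r_2 applies r_0, r_1, ..., r_{n-1}, r_0, ... to the
   flag of [P], so completing each round up to r_{n-1} gives flags in a
   single orbit of the Petrie step. *)
Definition derived_petrie_flag (u : flag D) : flag P :=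
  petrie_flag (gon_vertex u.1) (u.2 Phi).

(** Color 1 keeps the vertex of the n-gon. Color 2 on side [i] passes between the vertices
    [ord_pred i] and [i] while applying [r i], as in [petrie_flag_ordS]. *)
Lemma derived_petrie_polygon (C : pred 'I_3) (u v : flag D) :
    (forall c, C c -> 0 < c) -> joined C u v ->
  petrie_polygon (derived_petrie_flag u) (derived_petrie_flag v).
Proof.
move=> C_gt0 uv.
apply: (joined_invariant (Q := fun v => petrie_polygon (derived_petrie_flag u)
  (derived_petrie_flag v)) _ uv); last by exists 0; left.
move=> [[y c] g] /C_gt0; rewrite derived_term /derived_petrie_flag /=.
rewrite /term /= voltE /family1_r; case: c => [[|[|[|]]]] //= _ _.
  by rewrite gon_vertex_r1.
rewrite rho_spec aut_r //; case: y => i []; rewrite /gon_vertex /= => H.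
- have := petrie_flag_ordS (ord_pred i) (r i (g Phi)); rewrite ord_predK rK //.
  by case=> [<-|E] //; apply/(petrie_polygon_step P_polytope); rewrite -E.
- have := petrie_flag_ordS (ord_pred i) (g Phi); rewrite ord_predK.
  by case=> -> //; exact: (iffLR (petrie_polygon_step P_polytope _ _)).
Qed.

Lemma derived_facet (C : pred 'I_3) (u v : flag D) :
  (forall c, C c -> c < 2) -> joined C u v -> v.2 = u.2.
Proof.
move=> C_lt2 uv; apply: (@joined_invariant _ D (fun v => v.2 = u.2) C u v _ uv) => //.
by move=> [[y c] g] /C_lt2 lt_c; rewrite derived_term voltE ltn_eqF // mul1g.
Qed.

Lemma derived_edge (C : pred 'I_3) (u v : flag D) :
  (forall c, C c -> c != 1 :> nat) -> joined C u v -> v.1.1 = u.1.1.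
Proof.
move=> C_neq uv; apply: (@joined_invariant _ D (fun v => v.1.1 = u.1.1) C u v _ uv) => //.
by move=> [[y c] g] /C_neq /= neq <-; rewrite /term /= /family1_r (negPf neq).
Qed.

Lemma derived_polytope : polytope D.
Proof.
split; first by split; [apply: derived_premaniplex|apply: derived_simple].
move=> k m u v down up.
(* For [k = 0] or [m = 2] one of the two given paths already suffices. *)
have [k0|k_gt0] := posnP k.
  by apply: joined_sub down => i; rewrite /= -!topredE /= k0.
have [m_gt1|m_le1] := ltnP 1 m.
  apply: joined_sub up => i; rewrite -!topredE /= => ->.
  by apply: leq_trans m_gt1; rewrite -ltnS ltn_ord.
(* Here [k >= 1] and [m <= 1]: the flags share a facet and a vertex, so they agree up to color 1. *)
have E2 : v.2 = u.2 by apply: derived_facet down => c /leq_ltn_trans; apply.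
have Ev : gon_vertex u.1 = gon_vertex v.1.
  apply: (petrie_flag_inj_polygon P_polytope P_petrie (x := u.2 Phi)).
  have := derived_petrie_polygon (C := fun c => k <= c) _ up.
  by rewrite /derived_petrie_flag E2; apply => c; apply: leq_trans.
case: u v E2 Ev down up => [y g] [z h] /= -> /gon_vertex_inj [->|->] down up.
  exact: joined_refl.
(* As [gon_r1] changes the side, neither path can avoid color 1, which leaves [k = m = 1]. *)
have [m1|m0] := eqVneq (m : nat) 1; have [k1|k2] := eqVneq (k : nat) 1.
- by apply: derived_step1; rewrite /= m1 k1.
- case: (@gon_r1_edge y); apply: (derived_edge _ up) => c.
  by apply: contraTneq => ->; rewrite -ltnNge ltn_neqAle eq_sym k2.
- case: (@gon_r1_edge y); apply: (derived_edge _ down) => c.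
  by apply: contraTneq => ->; rewrite -ltnNge ltn_neqAle m0.
- case: (@gon_r1_edge y); apply: (derived_edge _ down) => c.
  by apply: contraTneq => ->; rewrite -ltnNge ltn_neqAle m0.
Qed.

(** * Right translations and transitivity on faces *)

Program Definition derived_rmul h : aut D :=
  @Iso _ D D (fun u => (u.1, (u.2 * h)%g)) (fun d => (d.1, (d.2 * h)%g))
    (fun u => (u.1, (u.2 * h^-1)%g)) (fun d => (d.1, (d.2 * h^-1)%g)) _ _ _ _ _ _ _.
Next Obligation. by move=> h [y g] /=; rewrite mulgK. Qed.
Next Obligation. by move=> h [y g] /=; rewrite mulgVK. Qed.
Next Obligation. by move=> h [y g] /=; rewrite mulgK. Qed.
Next Obligation. by move=> h [y g] /=; rewrite mulgVK. Qed.
Next Obligation. by []. Qed.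
Next Obligation. by move=> h [d g]; rewrite /= /derived_dinv /= mulgA. Qed.
Next Obligation. by []. Qed.

(** Voltages multiply on the left, so right translations are automorphisms; they are transitive on
    the fibre over [y]. *)
Lemma derived_face_transitive (k : nat) y :
    (forall u : flag D, exists g,
       joined (fun c => c != k :> nat) u ((y, g) : flag D)) ->
  face_transitive D k.
Proof.
move=> meet _ _ [u ->] [v ->]; have [[g ug] [h vh]] := (meet u, meet v).
exists (derived_rmul (g^-1 * h)%g); rewrite (eq_face ug) (eq_face vh) iso_face.
by rewrite /= mulVKg.
Qed.

Lemma derived_facet_transitive : facet_transitive D.
Proof.
apply: (@derived_face_transitive _ (ord0, false)) => -[y g]; exists g.
exact: derived_same_facet.
Qed.

(** From [(i, false)], color 1 and then color 2 lead to the preceding side, so every vertex reaches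
    side 0. *)
Lemma derived_vertex_transitive : vertex_transitive D.
Proof.
apply: (@derived_face_transitive _ (ord0, false)) => -[[i b] g].
pose C : pred 'I_3 := fun c => c != 0 :> nat.
suff base h : exists g', @joined _ D C ((i, false), h) ((ord0, false), g').
  case: b => //; have [g' H] := base (rho i * g)%g; exists g'.
  exact: joined_trans (@derived_step2 C (i, true) g _) H.
case: i h => k; elim: k => [|k IH] lt_k h.
  by exists h; rewrite (_ : Ordinal lt_k = ord0); [apply: joined_refl|apply: val_inj].
pose j := Ordinal (ltnW lt_k); have [g' H] := IH (ltnW lt_k) (rho j * h)%g.
exists g'; have E : ord_pred (Ordinal lt_k) = j.
  by rewrite -[RHS]ordSK; congr ord_pred; apply: val_inj; rewrite /= modn_small.
have s1 := @derived_step1 C (Ordinal lt_k, false) h (erefl _).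
have s2 := @derived_step2 C (j, true) h (erefl _).
rewrite /gon_r1 /= E in s1; exact: joined_trans s1 (joined_trans s2 H).
Qed.

(** * Rigidity of the automorphisms of the derived graph *)

Section Rigidity.
Variable f : aut D.

Let shadow y g : gon_flag n := (f (y, g)).1.
Let phi g : aut P := (f ((ord0, false), g)).2.

Let f0 y g : f (gon_r0 y, g) = (gon_r0 (f (y, g)).1, (f (y, g)).2).
Proof.
have := aut_r derived_premaniplex f c0 (y, g); case: (f (y, g)) => z h.
by rewrite !derived_r !voltE !mul1g.
Qed.

Let f1 y g : f (gon_r1 y, g) = (gon_r1 (f (y, g)).1, (f (y, g)).2).
Proof.
have := aut_r derived_premaniplex f c1 (y, g); case: (f (y, g)) => z h.
by rewrite !derived_r !voltE !mul1g.
Qed.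

Let f2 y g : f (gon_r0 y, (rho y.1 * g)%g) =
  (gon_r0 (f (y, g)).1, (rho (f (y, g)).1.1 * (f (y, g)).2)%g).
Proof.
have := aut_r derived_premaniplex f c2 (y, g); case: (f (y, g)) => z h.
by rewrite !derived_r !voltE.
Qed.

Let f_snd y g : (f (y, g)).2 = phi g.
Proof.
apply: (gon_ind (Q := fun z => (f (z, g)).2 = phi g) (y := (ord0, false))) => // z <-.
- by rewrite f0.
- by rewrite f1.
Qed.

(** Copies glued along side [i] agree on the image of this side, and an equivariant map of the n-gon
    is determined by one flag. *)
Let shadow_rho i g : shadow^~ (rho i * g)%g =1 shadow^~ g.
Proof.
apply: (gon_map_eq (y := (i, true))) => [z|z|z|z|]; rewrite /shadow ?f0 ?f1 //.
by have := f2 (i, false) g; have := f0 (i, false) g; rewrite /gon_r0 /= => -> ->.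
Qed.

Let phi_rho i g : phi (rho i * g)%g = (rho (shadow (i, false) g).1 * phi g)%g.
Proof. by rewrite -(f_snd (gon_r0 (i, false))) (f2 (i, false)) f_snd. Qed.

Let shadowE y g : shadow y g = shadow y 1%g.
Proof.
have [w] := walk_connected P_pre (g Phi) ((1%g : aut P) Phi).
elim: w g => [|i w IH] g /=; first by move=> E; rewrite -(@aut_eq_base 1%g g E).
by rewrite -rho_mul => /IH <-; rewrite shadow_rho.
Qed.

Lemma derived_aut_gon : exists F : gon_flag n -> gon_flag n,
  [/\ forall y g, (f (y, g)).1 = F y,
      forall y, F (gon_r0 y) = gon_r0 (F y),
      forall y, F (gon_r1 y) = gon_r1 (F y)
    & forall w, walk Phi w = Phi ->
        walk Phi (map (fun i => (F (i, false)).1) w) = Phi].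
Proof.
exists (shadow^~ 1%g); split=> [|y|y|w Ew]; first exact: shadowE.
- by rewrite /shadow f0.
- by rewrite /shadow f1.
set s := fun i => _.
(* Reading [w] in [P], the map [phi] translates each letter [i] into [s i]. *)
have lift g : exists h, h Phi = walk (g Phi) w /\
    phi h Phi = walk (phi g Phi) (map s w).
  elim: w g {Ew} => [|i w IH] g; first by exists g.
  have [h [E1 E2]] := IH (rho i * g)%g; exists h.
  by rewrite E1 E2 phi_rho !rho_mul shadowE.
have [h [E1 E2]] := lift 1%g.
have Eh : h = 1%g by apply: aut_eq_base; rewrite E1.
(* The automorphism [phi 1] commutes with walks, so the closed walk is carried back to [Phi]. *)
by apply: (can_inj (iso_flagK (phi 1%g))); rewrite (aut_walk P_pre) -E2 Eh.
Qed.

End Rigidity.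

Hypothesis P_nondegenerate : nondegenerate P.
Hypothesis P_not_self_dual : ~ self_dual P.

(** The boolean is an orientation, which [F] keeps or flips everywhere; the rotation
    [gon_r1 \o gon_r0] advances flags of one orientation and moves the others back. *)
Lemma gon_symmetry (F : gon_flag n -> gon_flag n) (s := fun i => (F (i, false)).1) :
    (forall y, F (gon_r0 y) = gon_r0 (F y)) ->
    (forall y, F (gon_r1 y) = gon_r1 (F y)) ->
  if (F (ord0, false)).2 then forall i, s (ordS i) = ord_pred (s i)
  else forall i, s (ordS i) = ordS (s i).
Proof.
move=> F0 F1; set b := (F _).2.
have side : forall y, (F y).2 = b (+) y.2.
  apply: (gon_ind (y := (ord0, false))) => [y E|y E|]; last by rewrite addbF.
  - by rewrite F0 /= E addbN.
  - by rewrite F1; case: y E => i []; case: (F _) => j [] /=; case: (b).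
have next i : F (ordS i, false) = gon_r1 (gon_r0 (F (i, false))) by rewrite -F0 -F1.
have := fun i => side (i, false); rewrite /s /= addbF.
by case: b {side} => E i; rewrite next; case: (F (i, false)) (E i) => j c /= ->.
Qed.

(* The relation (r_0 r_{n-1})^2 = 1 is sent to (r_i r_j)^2 = 1 with i, j
   cyclically adjacent; by non-degeneracy {i, j} = {0, n-1}, so the symmetry of
   the n-gon is the identity or the reversal i |-> n-1-i, which is a duality. *)
Lemma derived_aut_fixes_gon (f : aut D) (u : flag D) : (f u).1 = u.1.
Proof.
have [F [fF F0 F1 rel]] := derived_aut_gon f.
case: u => y g; rewrite fF /=; set s := fun i => _ in rel.
have [N0|N_gt0] := posnP N.
  case: P_not_self_dual; case: N P P_pre P_simple N0 => // Q ? ? _.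
  exact: polygon_self_dual.
have comm i j : (i.+1 < j) || (j.+1 < i) ->
    r (s j) (r (s i) (r (s j) (r (s i) Phi))) = Phi.
  by move=> ij; apply: (rel [:: i; j; i; j]); apply: r_comm.
have wrap : ordS (ord_max : 'I_n) = ord0 by apply: val_inj; rewrite /= modnn.
have val_ordS i : i != ord_max -> ordS i = i.+1 :> nat.
  move=> neq; rewrite /= modn_small // ltnS ltn_neqAle -ltnS ltn_ord andbT.
  by apply: contra neq => /eqP E; apply/eqP/val_inj.
have : if (F (ord0, false)).2 then forall i, s (ordS i) = ord_pred (s i)
       else forall i, s (ordS i) = ordS (s i) := gon_symmetry F0 F1.
case E2: (F _).2 => sS.
- have s0 : s ord0 = ord_max.
    have E : ordS (s ord0) = s ord_max by rewrite -{1}wrap sS ord_predK.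
    (* Otherwise [ordS] does not wrap and [s ord0], [s ord_max] are consecutive; [comm] applies to 0
       and n-1 because [N > 0]. *)
    apply/eqP/negP => /negP /val_ordS; rewrite E => {}E.
    apply: (P_nondegenerate (x := Phi) E).
    by apply: comm; apply/orP; right.
  case: P_not_self_dual; apply: (self_dual_walk P_pre (x0 := Phi)) => w /rel.
  rewrite (_ : map s w = map (@rev_ord n) w) //; apply: eq_map => -[].
  elim=> [|k IH] lt_k.
    rewrite (_ : Ordinal lt_k = ord0) ?s0; last exact: val_inj.
    by apply: val_inj; rewrite /= subn1.
  have -> : Ordinal lt_k = ordS (Ordinal (ltnW lt_k)).
    by apply: val_inj; rewrite /= modn_small.
  rewrite sS IH -[RHS]ordSK; congr ord_pred; apply: val_inj.
  by rewrite /= (modn_small lt_k) subnSK // subSS modn_small // ltnS leq_subr.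
- have s0 : s ord_max = ord_max.
    apply/eqP/negP => /negP /val_ordS; rewrite -sS wrap => E.
    apply: (P_nondegenerate (x := Phi) E).
    by apply: comm; apply/orP; left.
  apply: (gon_map_eq F0 F1 (h := id) (y := (ord0, false))) => //.
  have E1 : s ord0 = ord0 by rewrite -{1}wrap sS s0.
  by move: E1 E2; rewrite /s; case: (F _) => i b /= -> ->.
Qed.

(** * Orbits and the symmetry type graph *)

Let flag_of (O : flag_orbits D) : gon_flag n := (sval (cid (svalP O))).1.
Let dart_of (O : dart_orbits D) : dart (family1 n) := (sval (cid (svalP O))).1.

(** The chosen representative is immaterial because automorphisms fix the n-gon component. *)
Let flag_ofE (O : flag_orbits D) (u : flag D) : sval O u -> flag_of O = u.1.
Proof.
rewrite /flag_of; case: (cid _) => /= v ->; case=> f ->.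
by rewrite derived_aut_fixes_gon.
Qed.

Let dart_ofE (O : dart_orbits D) (d : dart D) : sval O d -> dart_of O = d.1.
Proof.
rewrite /dart_of; case: (cid _) => /= e ->; case=> f ->.
have := derived_aut_fixes_gon f (@init _ D e); have := @iso_color _ D D f e.
rewrite -(@iso_init _ D D) /=; case: (@iso_dart _ D D f e) => [[y c] g] /=.
by case: e => [[y' c'] g'] /= -> ->.
Qed.

(** Right translations merge each fibre into one orbit, and by rigidity no orbit meets two
    fibres. *)
Lemma derived_symmetry_type_graph : isomorphic (symmetry_type_graph D) (family1 n).
Proof.
pose orbit_of y : flag_orbits D :=
  exist _ (@flag_orbit _ D (y, 1%g)) (ex_intro _ ((y, 1%g) : flag D) erefl).
pose dorbit_of (d : dart (family1 n)) : dart_orbits D :=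
  exist _ (@dart_orbit _ D (d, 1%g)) (ex_intro _ ((d, 1%g) : dart D) erefl).
have flag_mem (O : flag_orbits D) : exists u, sval O u.
  by case: O => A [u EA]; exists u; rewrite /= EA; exists 1%g.
have dart_mem (O : dart_orbits D) : exists d, sval O d.
  by case: O => A [d EA]; exists d; rewrite /= EA; exists 1%g.
constructor.
apply: (@Iso _ (symmetry_type_graph D) (family1 n) flag_of dart_of orbit_of dorbit_of).
- move=> O; have [[y g] Ou] := flag_mem O; rewrite (flag_ofE Ou).
  case: O Ou => A [u EA] Ou; apply: eq_exist; rewrite /= EA.
  have [f E] : @flag_orbit _ D u (y, g) by rewrite -EA.
  rewrite -(flag_orbit_aut (derived_rmul g) (y, 1%g)) -(flag_orbit_aut f u) -E.
  by rewrite /= mul1g.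
- by move=> y; apply: (flag_ofE (u := (y, 1%g))); exists 1%g.
- move=> O; have [[d g] Od] := dart_mem O; rewrite (dart_ofE Od).
  case: O Od => A [e EA] Od; apply: eq_exist; rewrite /= EA.
  have [f E] : @dart_orbit _ D e (d, g) by rewrite -EA.
  rewrite -(dart_orbit_aut (derived_rmul g) (d, 1%g)) -(dart_orbit_aut f e) -E.
  by rewrite /= mul1g.
- by move=> d; apply: (dart_ofE (d := (d, 1%g))); exists 1%g.
- move=> O; have [d Od] := dart_mem O; rewrite (dart_ofE Od).
  by apply/esym/(flag_ofE (u := init d)); exists d.
- move=> O; have [d Od] := dart_mem O; rewrite (dart_ofE Od).
  by apply/esym/(dart_ofE (d := dinv d)); exists d.
- move=> O; have [d Od] := dart_mem O; rewrite (dart_ofE Od).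
  exact/esym/stg_colorE.
Qed.

(** The facet determines the group component and [f] preserves the n-gon component, so [f] fixes a
    flag. *)
Lemma derived_trivial_facet_stabilizer : trivial_facet_stabilizer D.
Proof.
move=> _ f [u ->] Ef.
have same : face 2 u (f u) by rewrite -Ef; exists u => //; apply: face_refl.
have E2 : (f u).2 = u.2.
  by apply: derived_facet same => c c_neq; rewrite ltn_neqAle c_neq -ltnS ltn_ord.
apply: (aut_eq derived_premaniplex (x := u)).
by rewrite [f u]surjective_pairing derived_aut_fixes_gon E2 -surjective_pairing.
Qed.

End Derived.

Theorem theorem6p3 (n : nat) (P : cgraph n)
  (P_polytope : polytope P) (P_regular : regular P)
  (P_petrie : simple_petrie_polygons P)
  (P_nondegenerate : nondegenerate P) (P_not_self_dual : ~ self_dual P)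
  (Phi : flag P) (rho : 'I_n -> aut P)
  (rho_spec : forall i : 'I_n, rho i Phi = r i Phi)
  (xi : voltage (family1 n) (aut P))
  (xi01 : forall d : dart (family1 n), (color d < 2)%N -> xi d = 1%g)
  (xi2 : forall (i : 'I_n) (d : dart (family1 n)),
     color d = 2%N :> nat -> family1_edge i (init d) -> xi d = rho i) :
  polytope (derived xi) /\
  isomorphic (symmetry_type_graph (derived xi)) (family1 n) /\
  vertex_transitive (derived xi) /\
  facet_transitive (derived xi) /\
  trivial_facet_stabilizer (derived xi).
Proof.
(* The sides above are numbered modulo [n >= 2]; for smaller [n] color reversal is trivial and [P]
   is self-dual. *)
case: (ltnP n 2) => [n_lt2|].
  by case: P_not_self_dual; apply: self_dual_small => //; case: P_polytope => -[].
case: n => [|[|N]] // in P P_polytope P_regular P_petrie P_nondegenerate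
  P_not_self_dual Phi rho rho_spec xi xi01 xi2 * => _.
split; first exact: (derived_polytope P_polytope rho_spec xi01 xi2 P_petrie).
split; first exact: (derived_symmetry_type_graph P_polytope rho_spec xi01 xi2).
split; first exact: (derived_vertex_transitive xi01 xi2).
split; first exact: (derived_facet_transitive xi01 xi2).
exact: (derived_trivial_facet_stabilizer P_polytope rho_spec xi01 xi2).
Qed.
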